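(* For every integer $t\ge 0$ there is a constant $c_t$ such that every graph $G$ with at least one vertex and $\mathrm{tww}(G)\le t$ satisfies $\gamma(G)\le c_t\,\gamma^*(G)$, where $\gamma(G)$ is the minimum size of a dominating set of $G$ and $\gamma^*(G)$ is the optimum value of the linear program: minimize $\sum_{x\in V(G)}w(x)$ subject to $\sum_{y\in N[x]}w(y)\ge 1$ for all $x\in V(G)$ and $0\le w(x)\le 1$ for all $x\in V(G)$.
   Context: $N[x]$ is the closed neighborhood of $x$ (its neighbors and $x$ itself). A dominating set is a set $S$ such that every vertex is in $S$ or has a neighbor in $S$. A trigraph $H$ consists of a vertex set $V(H)$ and two disjoint sets of unordered pairs of distinct vertices: black edges $E(H)$ and red edges $R(H)$. Two vertices are adjacent (neighbors) if they are joined by a black or a red edge. The red graph of $H$ is the graph $(V(H),R(H))$; $H$ is a $d$-trigraph if its red graph has maximum degree at most $d$. A graph is a trigraph with no red edges. Contracting two distinct vertices $u,v$ of a trigraph $H$ yields the trigraph obtained by deleting $u$ and $v$ and adding a new vertex $z$ such that, for every other vertex $x$: $zx$ is a black edge if both $ux$ and $vx$ are black edges; $zx$ is not an edge if $x$ is adjacent to neither $u$ nor $v$; and $zx$ is a red edge otherwise. All edges not incident to $u$ or $v$ are unchanged. A $d$-sequence of an $n$-vertex graph $G$ is a sequence of $d$-trigraphs $G=G_n,G_{n-1},\dots,G_1$ such that $G_1$ has a single vertex and each $G_{i-1}$ is obtained from $G_i$ by one contraction (so $G_i$ has $i$ vertices). The twin-width $\mathrm{tww}(G)$ of $G$ is the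 minimum $d$ such that $G$ admits a $d$-sequence. *)

(* Defs.v *)
From HB Require Import structures.
From mathcomp Require Import all_boot all_order all_algebra.
From mathcomp Require Import classical_sets reals.
Set Implicit Arguments. Unset Strict Implicit. Unset Printing Implicit Defensive.
Import Order.TTheory GRing.Theory Num.Theory.

(* A graph is given by T : finType and a symmetric irreflexive e : rel T. *)

Section TwinWidth.
Variable T : finType.

(* Trigraphs arising in a contraction sequence of a graph on T: vertices are
   named by (pairwise disjoint, nonempty) subsets of T; a contracted vertex
   z of u and v is named u :|: v (a fresh name).  Only the values of the edge
   relations between members of tV matter. *)
Record trigraph := Trigraph {
  tV : {set {set T}};
  tB : rel {set T};   (* black edges *)
  tR : rel {set T} }. (* red edges *)

Definition tadj (H : trigraph) x y := tB H x y || tR H x y.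

Definition contract (H : trigraph) (u v : {set T}) : trigraph :=
  let z := u :|: v in
  Trigraph (z |: (tV H :\ u :\ v))
    (fun x y => if x == z then (if y == z then false else tB H u y && tB H v y)
                else if y == z then tB H x u && tB H x v else tB H x y)
    (fun x y => if x == z then
                  (if y == z then false
                   else (tadj H u y || tadj H v y) && ~~ (tB H u y && tB H v y))
                else if y == z then
                  (tadj H x u || tadj H x v) && ~~ (tB H x u && tB H x v)
                else tR H x y).

Definition red_deg (H : trigraph) x := #|[set y in tV H | tR H x y]|.
Definition dtrigraph (d : nat) (H : trigraph) :=
  [forall x in tV H, red_deg H x <= d].

Definition graph_trigraph (e : rel T) : trigraph :=
  Trigraph [set [set x] | x : T]
    (fun X Y => [exists x in X, exists y in Y, e x y])
    (fun _ _ => false).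

Fixpoint contraction_seq (d : nat) (H : trigraph)
    (s : seq ({set T} * {set T})) : bool :=
  match s with
  | [::] => #|tV H| == 1
  | (u, v) :: s' =>
      [&& u \in tV H, v \in tV H, u != v,
          dtrigraph d (contract H u v) &
          contraction_seq d (contract H u v) s']
  end.

Definition has_dsequence (e : rel T) (d : nat) :=
  exists s, dtrigraph d (graph_trigraph e) &&
            contraction_seq d (graph_trigraph e) s.

Definition tww_le (e : rel T) (t : nat) :=
  exists d, (d <= t)%N /\ has_dsequence e d.

Definition cnbhd (e : rel T) (x : T) : {set T} := [set y | (y == x) || e x y].
Definition dominating (e : rel T) (S : {set T}) :=
  [forall x, [exists y in S, y \in cnbhd e x]].
Definition domination_number (e : rel T) : nat :=
  #|[arg min_(S < [set: T] | dominating e S) #|S|]|.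

Local Open Scope ring_scope.
Local Open Scope classical_set_scope.
Definition frac_dom_feasible (R : realType) (e : rel T) :=
  [set w : T -> R | (forall x, 1 <= \sum_(y in cnbhd e x) w y) /\
                    (forall x, 0 <= w x <= 1)].
Definition frac_domination_number (R : realType) (e : rel T) : R :=
  inf [set \sum_(x : T) w x | w in @frac_dom_feasible R e].
End TwinWidth.
Arguments frac_dom_feasible {T} R e.
Arguments frac_domination_number {T} R e.

(* Main.v *)
(** Order the vertices along the contraction sequence, so that every part that
ever occurs is an interval.  Cut the order into consecutive column blocks of
small weight, and again into row blocks, a zone being the product of a row
block and a column block.  A zone is mixed if neither its rows nor its columns
are all constant.  Charge a mixed zone to whichever of its two blocks is first
contained in a part: that part has at most [d] red neighbours, each of them an
interval splitting at most two blocks, so the number of mixed zones is linear in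
the number of blocks.  Hence the row blocks can be cut greedily to have few mixed
zones each while their number stays linear in the number of column blocks,
i.e. in the weight of the fractional solution.  The mixed zones of a row block
then carry weight less than 1, so every closed neighbourhood meets a non-mixed
zone: it contains a whole column block, or a vertex adjacent to the whole row
block.  A mark per column block and a common neighbour per row block dominate. *)

Require Import Defs.
From HB Require Import structures.
From mathcomp Require Import all_boot all_order all_algebra.
From mathcomp Require Import classical_sets reals.
From mathcomp Require Import zify.
Import Order.TTheory GRing.Theory Num.Theory.
Set Implicit Arguments. Unset Strict Implicit. Unset Printing Implicit Defensive.

(** * Cutting a sequence into consecutive blocks *)

Section Blocks.
Variable A : eqType.
Implicit Types (p : pred A) (s : seq A) (ss : seq (seq A)).

Fixpoint changes p s : nat :=
  if s is x :: s' then
    (if s' is y :: _ then (p x != p y : nat) else 0) + changes p s'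
  else 0.

Lemma changes_cat p s1 s2 :
  changes p s1 + changes p s2 <= changes p (s1 ++ s2)
    <= (changes p s1 + changes p s2).+1.
Proof.
elim: s1 => [|x [|y s1] IH] /=; first by rewrite add0n leqnn leqnSn.
  by case: s2 {IH} => [|y s2] //=; case: (p x != p y); lia.
by move: IH => /=; lia.
Qed.

Lemma changes_const p b s : {in s, forall x, p x = b} -> changes p s = 0.
Proof.
elim: s => [|x [|y s] IH] // ps.
have -> : changes p [:: x, y & s] = (p x != p y) + changes p (y :: s) by [].
rewrite !ps ?inE ?eqxx ?orbT // IH // => z zs.
by rewrite ps // inE zs orbT.
Qed.

Definition split_by p s := has p s && has (predC p) s.

Lemma split_by_changes p s : split_by p s -> 0 < changes p s.
Proof.
move=> /andP[+ +]; elim: s => [|x [|y s] IH] //=; first by case: (p x).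
move: IH => /=; case: (p x); case: (p y) => //= IH _ _; lia.
Qed.

(** A split block has a change of [p] in its interior, and concatenating blocks never destroys
    interior changes. *)
Lemma count_split_by p ss : count (split_by p) ss <= changes p (flatten ss).
Proof.
elim: ss => //= s ss IH; have := @changes_cat p s (flatten ss).
have := @split_by_changes p s; case: (split_by p s) => /=; lia.
Qed.

(** The predicate is constant before, on and after the infix, and each of the two junctions adds at
    most one change. *)
Lemma changes_infix p s s0 : uniq s0 -> infix s s0 -> s =i p ->
  changes p s0 <= 2.
Proof.
move=> us0 /infixP[s1 [s3 def_s0]] sp; move: us0.
rewrite {}def_s0 cat_uniq => /and3P[_ d1 +].
rewrite cat_uniq => /and3P[_ d2 _].
have c1 : changes p s1 = 0.
  apply: (@changes_const _ false) => x xs; apply: contraNF d1 => px.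
  by apply/hasP; exists x => //; rewrite mem_cat sp unfold_in /= px.
have c3 : changes p s3 = 0.
  apply: (@changes_const _ false) => x xs; apply: contraNF d2 => px.
  by apply/hasP; exists x => //=; rewrite sp.
have c2 : changes p s = 0.
  by apply: (@changes_const _ true) => x; rewrite sp.
have := @changes_cat p s1 (s ++ s3); have := @changes_cat p s s3; lia.
Qed.

(* Cut off a block as soon as it becomes bad; a bad block minus its last
   element is then not bad. *)
Lemma greedy_blocks (bad : pred (seq A)) s : ~~ bad [::] ->
  exists (ss : seq (seq A)) (marks : seq A),
    [/\ flatten ss = s, size ss <= (count bad ss).+1,
        size marks <= size ss,
        {in ss, forall b x, x \in b -> has (mem marks) b} &
        {in ss, forall b, exists2 b', ~~ bad b' &
           {in b, forall x, x \notin marks -> x \in b'}}].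
Proof.
move=> bad0.
suff [ss [r [marks [-> allbad badr szm hss]]]] :
  exists (ss : seq (seq A)) (r marks : seq A),
    [/\ s = flatten ss ++ r, all bad ss, ~~ bad r, size marks = size ss &
     {in ss, forall b, has (mem marks) b /\ exists2 b', ~~ bad b' &
           {in b, forall x, x \notin marks -> x \in b'}}].
  (* The open remainder [r] becomes the last block. It is the only one that is not bad, hence the
     successor in the size bound; its first element, if any, is marked so that every nonempty block
     has a mark. *)
  exists (rcons ss r), (marks ++ take 1 r); split.
  - by rewrite flatten_rcons.
  - move: allbad; rewrite all_count size_rcons -cats1 count_cat => /eqP->.
    by rewrite ltnS leq_addr.
  - by rewrite size_cat szm size_rcons -(addn1 (size ss)) leq_add2l size_take_min geq_minl.
  - move=> b; rewrite mem_rcons inE => /predU1P[->|/hss[hm _]] x xb.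
      case: r xb {badr} => // y r _; apply/hasP; exists y; rewrite ?mem_head //=.
      by rewrite mem_cat inE eqxx orbT.
    by apply: sub_has hm => y /=; rewrite mem_cat => ->.
  - move=> b; rewrite mem_rcons inE => /predU1P[->|/hss[_ [b' bb' sub]]].
      by exists r.
    exists b' => // x xb; rewrite mem_cat negb_or => /andP[xm _].
    exact: sub.
elim/last_ind: s => [|s x [ss [r [marks [-> allbad badr szm hss]]]]].
  by exists [::], [::], [::].
have [badrx|badrx] := boolP (bad (rcons r x)); last first.
  by exists ss, (rcons r x), marks; rewrite -rcons_cat.
exists (rcons ss (rcons r x)), [::], (rcons marks x); split=> //.
- by rewrite flatten_rcons cats0 -rcons_cat.
- by rewrite all_rcons badrx.
- by rewrite !size_rcons szm.
move=> b; rewrite mem_rcons inE => /predU1P[->|/hss[hm [b' bb' sub]]]; split.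
- by apply/hasP; exists x; rewrite /= mem_rcons mem_head.
- exists r => // y; rewrite !mem_rcons !inE => /predU1P[->|//].
  by rewrite eqxx.
- by apply: sub_has hm => y /=; rewrite mem_rcons inE => ->; rewrite orbT.
- exists b' => // y yb; rewrite mem_rcons inE negb_or => /andP[_].
  exact: sub.
Qed.

End Blocks.

(** * Counting mixed zones along a sequence of merged partitions *)

Section MixedZones.
Variables (T : finType) (a : rel T).
Hypothesis a_sym : symmetric a.
Implicit Types (I J : seq T) (X Y : {set T}) (P : {set {set T}}).

Definition homogeneous X Y :=
  [forall x in X, forall x' in X, forall y in Y, forall y' in Y,
     a x y == a x' y'].

Definition varies I J := has (fun x => has (fun y => has (fun y' =>
  a x y != a x y') J) J) I.

Definition mixed I J := varies I J && varies J I.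

Lemma mixedC I J : mixed I J = mixed J I.
Proof. exact: andbC. Qed.

Definition contained P I := [exists X in P, all (mem X) I].

Definition merge P X Y := (X :|: Y) |: (P :\ X :\ Y).

Lemma contained_merge P X Y I : contained P I -> contained (merge P X Y) I.
Proof.
move=> /exists_inP[Z ZP /allP sub]; apply/exists_inP.
have [ZXY|] := boolP (Z \in [set X; Y]); last first.
  rewrite !inE negb_or => /andP[ZX ZY].
  by exists Z; [rewrite !inE ZX ZY ZP orbT | apply/allP].
exists (X :|: Y); first by rewrite !inE eqxx.
apply/allP => x /sub /= xZ; rewrite inE.
by move: ZXY; rewrite !inE => /orP[]/eqP <-; rewrite xZ ?orbT.
Qed.

(** This is all that the counting uses of a trigraph. The bound is [d.+1] because a part may be
    inhomogeneous to itself besides its [d] red neighbours; at most two changes along [L] is what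
    being an interval gives. *)
Record low_defect (d : nat) (L : seq T) P : Prop := LowDefect {
  low_defect_cover : forall x, exists2 X, X \in P & x \in X;
  low_defect_deg : {in P, forall X,
    #|[set Y in P | ~~ homogeneous X Y]| <= d.+1};
  low_defect_interval : {in P, forall X : {set T}, changes (mem X) L <= 2} }.

Inductive merge_sequence (d : nat) (L : seq T) P : Prop :=
| merge_last : P = [set [set: T]] -> merge_sequence d L P
| merge_step X Y : X \in P -> Y \in P -> low_defect d L (merge P X Y) ->
    merge_sequence d L (merge P X Y) -> merge_sequence d L P.

(* A block J mixed with I contains a vertex y whose column is not constant on
   I; the part of P around y is X, Y or not homogeneous to the part around I,
   and it splits J. *)
Lemma count_mixed_contained d L P X Y Js I :
  low_defect d L P -> low_defect d L (merge P X Y) -> X \in P -> Y \in P ->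
  flatten Js = L -> contained (merge P X Y) I ->
  count (fun J => mixed I J && ~~ contained P J) Js <= (2 * d.+3)%N.
Proof.
move=> lP lP' XP YP fJ /exists_inP[Z ZP' /allP IZ].
(* [Z] is a part after the merge, whereas [J] is split by a part before it. A part other than [X]
   and [Y] lives in both partitions, so the degree bound of the merged one applies to it. *)
pose Ys := [set X; Y] :|: [set V in merge P X Y | ~~ homogeneous Z V].
pose Ys' := Ys :&: P.
have sub J : mixed I J && ~~ contained P J ->
    [exists V in Ys', split_by (mem V) J].
  case/andP=> /andP[_ /hasP[y yJ /hasP[x xI /hasP[x' x'I axy]]]] nJ.
  have [V VP yV] := low_defect_cover lP y.
  apply/exists_inP; exists V; last first.
    apply/andP; split; first by apply/hasP; exists y.
    rewrite has_predC; apply: contraNN nJ => VJ.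
    by apply/exists_inP; exists V.
  rewrite inE VP andbT 2!inE; case: (boolP (V \in [set X; Y])) => //=.
  rewrite !inE negb_or => /andP[VX VY]; rewrite VX VY VP /= orbT /=.
  apply: contra axy => /forall_inP/(_ _ (IZ _ xI))/forall_inP/(_ _ (IZ _ x'I)).
  by move=> /forall_inP/(_ _ yV)/forall_inP/(_ _ yV); rewrite ![a y _]a_sym.
apply: leq_trans (sub_count sub Js) _.
have -> : count (fun J => [exists V in Ys', split_by (mem V) J]) Js =
          \sum_(J <- Js) [exists V in Ys', split_by (mem V) J].
  by rewrite -sum1_count big_mkcond; apply: eq_bigr => J _; case: ifP.
apply: (@leq_trans (\sum_(J <- Js) \sum_(V in Ys') split_by (mem V) J)).
  apply: leq_sum => J _; case: exists_inP => // -[V VYs sV].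
  by rewrite (bigD1 V) //= sV.
rewrite exchange_big /=.
(* Each part in [Ys'] splits at most two blocks, and there are at most [2 + d.+1] such parts. *)
apply: (@leq_trans (\sum_(V in Ys') 2)).
  apply: leq_sum => V; rewrite inE => /andP[_ VP].
  apply: leq_trans (low_defect_interval lP VP).
  rewrite -fJ; apply: leq_trans (count_split_by _ _).
  by rewrite -sum1_count [leqRHS]big_mkcond /=; apply: leq_sum => J _; case: split_by.
rewrite sum_nat_const mulnC leq_mul2l /=.
apply: leq_trans (subset_leq_card (subsetIl _ _)) _.
apply: leq_trans (leq_card_setU _ _) _.
rewrite cards2 -[d.+3]/(2 + d.+1); apply: leq_add; first by case: (X != Y).
by have := low_defect_deg lP' ZP'.
Qed.

(** Induction along the merges, over the zones neither of whose blocks lies in a part yet. Each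
    block that a merge newly contains accounts for at most [2 * d.+3] mixed zones, which its own
    term on the right pays for; in the last partition every block is contained. *)
Lemma mixed_pairs_bound d L P Is Js :
  low_defect d L P -> merge_sequence d L P ->
  flatten Is = L -> flatten Js = L ->
  \sum_(I <- Is | ~~ contained P I) \sum_(J <- Js | ~~ contained P J) mixed I J
   <= 2 * d.+3 * (count (predC (contained P)) Is
                  + count (predC (contained P)) Js).
Proof.
move=> + ms fI fJ.
elim: ms => [{}P ->|{}P X Y XP YP lP' _ IH] lP.
  rewrite big1 // => I /negP[]; apply/exists_inP.
  by exists [set: T]; [rewrite inE | apply/allP => x _; rewrite inE].
set P' := merge P X Y in lP' IH *.
have {}IH := IH lP'.
have cnt (Bs : seq (seq T)) : count (predC (contained P)) Bs =
    count (predC (contained P')) Bs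
    + count (fun I => contained P' I && ~~ contained P I) Bs.
  elim: Bs => //= B Bs ->; have := @contained_merge P X Y B.
  by rewrite -/P'; case: (contained P B); case: (contained P' B) => //= h; lia.
have half (As Bs : seq (seq T)) : flatten Bs = L ->
  \sum_(I <- As | contained P' I && ~~ contained P I)
     \sum_(J <- Bs | ~~ contained P J) mixed I J
   <= 2 * d.+3 * count (fun I => contained P' I && ~~ contained P I) As.
  move=> fB; rewrite -sum1_count big_distrr /=.
  apply: leq_sum => I /andP[cI _]; rewrite muln1.
  apply: leq_trans (count_mixed_contained lP lP' XP YP fB cI).
  rewrite -sum1_count big_mkcond [X in _ <= X]big_mkcond /=.
  by apply: leq_sum => J _; case: mixed; case: contained.
rewrite !cnt.
have h1 := half Is Js fJ; have h2 := half Js Is fI.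
(* A zone open at [P] either stays open at [P'] or has a newly contained block; counting a zone with
   two such blocks twice is harmless. *)
apply: (@leq_trans (
  \sum_(I <- Is | ~~ contained P' I) \sum_(J <- Js | ~~ contained P' J) mixed I J
  + (\sum_(I <- Is | contained P' I && ~~ contained P I)
     \sum_(J <- Js | ~~ contained P J) mixed I J
  + \sum_(J <- Js | contained P' J && ~~ contained P J)
     \sum_(I <- Is | ~~ contained P I) mixed J I))); last by lia.
rewrite [X in _ + (_ + X)](exchange_big_dep (fun I => ~~ contained P I)) //=.
rewrite big_mkcond /= [X in _ <= X + _]big_mkcond /=.
rewrite [X in _ <= _ + (X + _)]big_mkcond /=.
rewrite [X in _ <= _ + (_ + X)]big_mkcond /= -!big_split /=.
apply: leq_sum => I _.
have := @contained_merge P X Y I; rewrite -/P'.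
case: (contained P I); case: (contained P' I) => //= _.
  by rewrite add0n leq_addr.
rewrite add0n big_mkcond /= [X in _ <= X + _]big_mkcond /=.
rewrite [X in _ <= _ + X]big_mkcond /= -big_split /=.
apply: leq_sum => J _; rewrite mixedC.
by case: (contained P J); case: (contained P' J); rewrite /= ?add0n ?addn0.
Qed.

(** A block inside a singleton has only one distinct vertex, so it is in no mixed zone; restricting
    the sum to uncontained blocks loses nothing. *)
Lemma total_mixed_bound d L Is Js :
  low_defect d L [set [set x] | x : T] ->
  merge_sequence d L [set [set x] | x : T] ->
  flatten Is = L -> flatten Js = L ->
  \sum_(I <- Is) count (mixed I) Js <= 2 * d.+3 * (size Is + size Js).
Proof.
move=> lP ms fI fJ; set P := (X in low_defect _ _ X) in lP ms.
have nmix I J : contained P I -> mixed I J = false.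
  move=> /exists_inP[_ /imsetP[x _ ->] /allP Ix]; apply/negP => /andP[_].
  move=> /hasP[y _ /hasP[u /Ix + /hasP[v /Ix]]] /=.
  by rewrite !inE => /eqP-> /eqP->; rewrite eqxx.
apply: leq_trans (leq_trans (mixed_pairs_bound lP ms fI fJ) _).
  rewrite [X in _ <= X]big_mkcond /=; apply: leq_sum => I _.
  rewrite -sum1_count big_mkcond /=; case: ifPn => [_|/negbNE cI].
    rewrite [X in _ <= X]big_mkcond /=; apply: leq_sum => J _.
    by rewrite mixedC; case: ifPn => // mJI; case: ifPn => // /negbNE /nmix h; rewrite h in mJI.
  by rewrite big1 // => J _; rewrite nmix.
by rewrite leq_mul2l leq_add ?orbT ?count_size.
Qed.

End MixedZones.

(** * From contraction sequences to merged partitions and a vertex order *)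

Section ContractionSequences.
Variables (T : finType) (e : rel T).
Hypothesis e_sym : symmetric e.

Definition closed_adj : rel T := fun x y => (y == x) || e x y.

Lemma closed_adj_sym : symmetric closed_adj.
Proof. by move=> x y; rewrite /closed_adj eq_sym e_sym. Qed.

(** Invariant of contraction: the vertices of [H] partition [T], black pairs are complete and
    nonadjacent pairs are empty in [e], and red pairs are unconstrained. *)
Record represents (H : trigraph T) : Prop := Represents {
  rep_cover : forall x, exists2 X, X \in tV H & x \in X;
  rep_disjoint : forall X Y x, X \in tV H -> Y \in tV H ->
    x \in X -> x \in Y -> X = Y;
  rep_nonempty : forall X, X \in tV H -> exists x, x \in X;
  rep_black : forall X Y x y, X \in tV H -> Y \in tV H -> X != Y ->
    tB H X Y -> x \in X -> y \in Y -> e x y;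
  rep_white : forall X Y x y, X \in tV H -> Y \in tV H -> X != Y ->
    ~~ tadj H X Y -> x \in X -> y \in Y -> ~~ e x y }.

Lemma represents_graph : represents (graph_trigraph e).
Proof.
split=> /=.
- by move=> x; exists [set x]; rewrite ?set11 ?imset_f.
- by move=> _ _ x /imsetP[y _ ->] /imsetP[z _ ->] /set1P-> /set1P->.
- by move=> _ /imsetP[x _ ->]; exists x; rewrite set11.
- move=> _ _ x y /imsetP[x' _ ->] /imsetP[y' _ ->] _.
  move=> /exists_inP[x1 /set1P-> /exists_inP[y1 /set1P->]] exy.
  by move=> /set1P-> /set1P->.
- move=> _ _ x y /imsetP[x' _ ->] /imsetP[y' _ ->] _; rewrite /tadj orbF.
  move=> + xX yY; apply: contra => exy.
  by apply/exists_inP; exists x => //; apply/exists_inP; exists y.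
Qed.

Variant merge_spec (P : {set {set T}}) (u v X : {set T}) : Prop :=
| MergeNew of X = u :|: v
| MergeOld of X \in P & X != u & X != v & X != u :|: v.

(** The name [u :|: v] is fresh: an old part equal to it would meet [u], hence be [u] by
    disjointness. This lets the tests in [contract] be evaluated on old parts. *)
Lemma mem_merge H u v X : represents H -> u \in tV H -> v \in tV H ->
  X \in merge (tV H) u v -> merge_spec (tV H) u v X.
Proof.
move=> rH uH vH; rewrite !inE => /predU1P[->|]; first exact: MergeNew.
case/and3P=> Xv Xu XH; apply: MergeOld => //; apply: contra Xu => /eqP Xuv.
have [x xu] := rep_nonempty rH uH.
by rewrite (rep_disjoint rH XH uH _ xu) // Xuv inE xu.
Qed.

Lemma represents_contract H u v : represents H -> u \in tV H -> v \in tV H ->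
  represents (contract H u v).
Proof.
move=> rH uH vH; have merge_cases := mem_merge rH uH vH.
split; rewrite [tV _]/=.
- move=> x; have [X XH xX] := rep_cover rH x.
  have [/orP XE|] := boolP ((X == u) || (X == v)).
    exists (u :|: v); first by rewrite !inE eqxx.
    by rewrite inE; case: XE xX => /eqP-> ->; rewrite ?orbT.
  by rewrite negb_or => /andP[Xu Xv]; exists X => //; rewrite !inE Xu Xv XH orbT.
- have old X x : X \in tV H -> X != u -> X != v -> x \in X -> x \in u :|: v ->
      False.
    move=> XH Xu Xv xX; rewrite inE => /orP[xu|xv].
      by rewrite (rep_disjoint rH XH uH xX xu) eqxx in Xu.
    by rewrite (rep_disjoint rH XH vH xX xv) eqxx in Xv.
  move=> X Y x /merge_cases[->|XH Xu Xv _] /merge_cases[->|YH Yu Yv _] //.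
  + by move=> xz xY; case: (old Y x).
  + by move=> xX xz; case: (old X x).
  + exact: (rep_disjoint rH).
- move=> X /merge_cases[->|XH _ _ _]; last exact: (rep_nonempty rH).
  by have [x xu] := rep_nonempty rH uH; exists x; rewrite inE xu.
- move=> X Y x y /merge_cases[->|XH Xu Xv Xz] /merge_cases[->|YH Yu Yv Yz];
    rewrite /= ?eqxx //.
  + rewrite (negPf Yz) => _ /andP[Bu Bv]; rewrite inE => /orP[] xz yY.
      by apply: rep_black Bu xz yY; rewrite // eq_sym.
    by apply: rep_black Bv xz yY; rewrite // eq_sym.
  + rewrite (negPf Xz) => _ /andP[Bu Bv] xX; rewrite inE => /orP[] yz.
      exact: rep_black Bu xX yz.
    exact: rep_black Bv xX yz.
  + by rewrite (negPf Xz) (negPf Yz) => XY; apply: rep_black.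
- move=> X Y x y /merge_cases[->|XH Xu Xv Xz] /merge_cases[->|YH Yu Yv Yz];
    rewrite /tadj /= ?eqxx ?(negPf Xz) ?(negPf Yz) //.
  + move=> _ W; have {W} : ~~ tadj H u Y /\ ~~ tadj H v Y.
      by move: W; rewrite /tadj; do 4!case: (_ H _ _).
    move=> [Wu Wv]; rewrite inE => /orP[] xz yY.
      by apply: rep_white Wu xz yY; rewrite // eq_sym.
    by apply: rep_white Wv xz yY; rewrite // eq_sym.
  + move=> _ W; have {W} : ~~ tadj H X u /\ ~~ tadj H X v.
      by move: W; rewrite /tadj; do 4!case: (_ H _ _).
    move=> [Wu Wv] xX; rewrite inE => /orP[] yz.
      exact: rep_white Wu xX yz.
    exact: rep_white Wv xX yz.
  + by move=> XY W; apply: rep_white W.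
Qed.

Lemma represents_red H X Y : represents H -> X \in tV H -> Y \in tV H ->
  ~~ homogeneous closed_adj X Y -> (Y == X) || tR H X Y.
Proof.
move=> rH XH YH; apply: contraR; rewrite negb_or eq_sym => /andP[XY nR].
have ex x y : x \in X -> y \in Y -> closed_adj x y = tB H X Y.
  move=> xX yY; rewrite /closed_adj; case: eqP => [yx|_] /=.
    by rewrite (rep_disjoint rH XH YH xX) ?eqxx -?yx in XY.
  case: (boolP (tB H X Y)) => B; first exact: rep_black B xX yY.
  by apply: negbTE; apply: (rep_white rH XH YH XY _ xX yY); rewrite /tadj negb_or B.
apply/forall_inP => x xX; apply/forall_inP => x' x'X.
by apply/forall_inP => y yY; apply/forall_inP => y' y'Y; rewrite !ex.
Qed.

Lemma represents_low_defect d H L (f : {set T} -> seq T) :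
  represents H -> dtrigraph d H -> uniq L ->
  {in tV H, forall X : {set T}, f X =i X /\ infix (f X) L} ->
  low_defect closed_adj d L (tV H).
Proof.
move=> rH /forall_inP dH uL fL; split; first exact: rep_cover.
  move=> X XH; apply: (@leq_trans #|X |: [set Y in tV H | tR H X Y]|).
    apply/subset_leq_card/fintype.subsetP => Y; rewrite !inE => /andP[YH nh].
    by rewrite YH; apply: represents_red nh.
  by rewrite cardsU1 -add1n leq_add ?leq_b1 ?dH.
by move=> X XH; have [fX iX] := fL X XH; apply: changes_infix iX fX.
Qed.

(** The order [L] is known only after the last contraction, so the induction carries an order [f X]
    of each current part. Contracting concatenates the orders of [u] and [v], so all earlier orders
    survive as infixes. *)
Lemma contraction_merge_sequence d H s (f : {set T} -> seq T) :
  represents H -> contraction_seq d H s ->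
  {in tV H, forall X : {set T}, uniq (f X) /\ f X =i X} ->
  exists L, [/\ uniq L, forall x, x \in L,
     {in tV H, forall X : {set T}, infix (f X) L} &
     merge_sequence closed_adj d L (tV H)].
Proof.
elim: s H f => [|[u v] s IH] H f rH /=.
  move=> /cards1P[X tVX] fH; have XH : X \in tV H by rewrite tVX set11.
  have XT : X = [set: T].
    apply/setP => x; rewrite inE; have [Y] := rep_cover rH x.
    by rewrite tVX => /set1P->.
  have [uX fX] := fH X XH; exists (f X); split=> //.
  - by move=> x; rewrite fX XT inE.
  - by move=> Y; rewrite tVX => /set1P->; apply: infix_refl.
  - by apply: merge_last; rewrite tVX XT.
case/and5P=> uH vH uv dH' cs fH.
pose g X := if X == u :|: v then f u ++ f v else f X.
have rH' := represents_contract rH uH vH.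
have gH : {in tV (contract H u v), forall X : {set T}, uniq (g X) /\ g X =i X}.
  move=> X /(mem_merge rH uH vH)[->|XH _ _ Xz]; rewrite /g ?eqxx ?(negPf Xz);
    last exact: fH.
  have [uu fu] := fH u uH; have [uv' fv] := fH v vH; split; last first.
    by move=> x; rewrite mem_cat fu fv inE.
  rewrite cat_uniq uu uv' andbT; apply: contra uv => /hasP[x].
  by rewrite /= fu fv => xv xu; apply/eqP; apply: (rep_disjoint rH uH vH xu xv).
have [L [uL allL gL ms]] := IH _ g rH' cs gH.
exists L; split=> //; last first.
  apply: merge_step uH vH _ ms; apply: (represents_low_defect (f := g) rH' dH' uL).
  by move=> X XH; have [_ gX] := gH X XH; split=> //; apply: gL.
have : infix (f u ++ f v) L.
  by have := gL (u :|: v); rewrite /g eqxx; apply; rewrite !inE eqxx.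
move=> iuv X XH; have [->|Xu] := eqVneq X u.
  exact: catr_infix iuv.
have [->|Xv] := eqVneq X v.
  exact: catl_infix iuv.
have XH' : X \in tV (contract H u v) by rewrite !inE Xu Xv XH orbT.
have := gL X XH'; rewrite /g; case: eqP => // Xz.
have [x xu] := rep_nonempty rH uH.
by rewrite (rep_disjoint rH XH uH _ xu) ?eqxx // Xz inE xu in Xu.
Qed.

Lemma dsequence_blocks d : has_dsequence e d ->
  exists L, [/\ uniq L, forall x, x \in L &
    forall Is Js, flatten Is = L -> flatten Js = L ->
      \sum_(I <- Is) count (mixed closed_adj I) Js
        <= 2 * d.+3 * (size Is + size Js)].
Proof.
move=> [s /andP[dG cs]]; pose f (X : {set T}) := enum X.
have fG : {in tV (graph_trigraph e), forall X : {set T}, uniq (f X) /\ f X =i X}.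
  by move=> X _; split; [apply: enum_uniq | apply: mem_enum].
have rG := represents_graph.
have [L [uL allL iL ms]] := contraction_merge_sequence rG cs fG.
exists L; split=> // Is Js fI fJ.
apply: total_mixed_bound closed_adj_sym _ _ _ _ _ ms fI fJ.
apply: (represents_low_defect (f := f) rG dG uL) => X XG.
by have [_ fX] := fG X XG; split=> //; apply: iL.
Qed.

End ContractionSequences.

(** * Rounding a fractional dominating function *)

Section FractionalDomination.
Variables (R : realFieldType) (T : finType).
Local Open Scope ring_scope.
Implicit Types (w : T -> R) (Js : seq (seq T)).

Lemma sum_sub_seq w (p : pred T) s : (forall x, 0 <= w x) ->
  (forall x, p x -> x \in s) -> \sum_(x | p x) w x <= \sum_(x <- s) w x.
Proof.
move=> w0; elim: s p => [|y s IH] p ps.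
  by rewrite big_nil big1 // => x /ps.
rewrite big_cons; case: (boolP (p y)) => py.
  rewrite (bigD1 y) //= lerD2l; apply: IH => x /andP[/ps].
  by rewrite inE => /predU1P[->|//]; rewrite eqxx.
rewrite -[leLHS]add0r lerD //; apply: IH => x px.
by move: (ps x px); rewrite inE => /predU1P[xy|//]; rewrite -xy px in py.
Qed.

Lemma sum_cover w Js (p : pred T) (q : pred (seq T)) (r : seq T -> pred T) :
  (forall x, 0 <= w x) ->
  (forall x, p x -> exists J, [/\ J \in Js, q J & r J x]) ->
  \sum_(x | p x) w x <= \sum_(J <- Js | q J) \sum_(x | r J x) w x.
Proof.
move=> w0; elim: Js p => [|J Js IH] p cov.
  by rewrite big_nil big1 // => x /cov[J []].
have sum0 (s : pred T) : 0 <= \sum_(x | s x) w x by apply: sumr_ge0.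
rewrite big_cons (bigID (fun x => q J && r J x)) /=.
have IHp : \sum_(x | p x && ~~ (q J && r J x)) w x <=
    \sum_(J0 <- Js | q J0) \sum_(x | r J0 x) w x.
  apply: IH => x /andP[/cov[J' [J'Js qJ' rJ']] nJ]; exists J'; split=> //.
  move: J'Js; rewrite inE => /predU1P[JJ'|//].
  by rewrite -JJ' qJ' rJ' in nJ.
case: (q J) IHp => /= IHp; last first.
  by rewrite big_pred0 ?add0r // => x; rewrite andbF.
rewrite lerD //; rewrite big_mkcond [leRHS]big_mkcond; apply: ler_sum => x _ /=.
by case: (p x); case: (r J x) => //=.
Qed.

Lemma domination_number_le (e : rel T) (D : seq T) :
  (forall x, has (closed_adj e x) D) -> (domination_number e <= size D)%N.
Proof.
move=> domD; rewrite /domination_number; case: arg_minnP => [|S _ minS].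
  apply/forallP => x; apply/exists_inP; exists x; rewrite inE ?eqxx //.
apply: leq_trans (minS [set x in D] _) _.
  apply/forallP => x; have /hasP[y yD xy] := domD x.
  by apply/exists_inP; exists y; rewrite inE.
by rewrite cardsE card_size.
Qed.

(** Markov's inequality over disjoint blocks. *)
Lemma count_heavy_blocks w (k : R) Js : (forall x, 0 <= w x) ->
  uniq (flatten Js) -> 0 <= k ->
  (count (fun J => 1 < k * \sum_(x <- J) w x) Js)%:R <= k * \sum_x w x.
Proof.
move=> w0 uJs k0.
apply: (@le_trans _ _ (\sum_(J <- Js) k * \sum_(x <- J) w x)).
  rewrite -sum1_count natr_sum big_mkcond; apply: ler_sum => J _.
  by case: ifP => [/ltW//|_]; rewrite mulr_ge0 ?sumr_ge0.
rewrite -mulr_sumr ler_wpM2l // -big_flatten big_uniq //=.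
by rewrite [leRHS](bigID (fun x => x \in flatten Js)) /= lerDl sumr_ge0.
Qed.

Lemma count_sum_bound (A : Type) (m : nat) (f : A -> nat) (s : seq A) :
  (m * count (fun x => m < f x)%N s <= \sum_(x <- s) f x)%N.
Proof.
rewrite -sum1_count big_distrr /= big_mkcond; apply: leq_sum => x _.
by case: ifP => // /ltnW; rewrite muln1.
Qed.

Lemma domination_number_le_weight (e : rel T) (d : nat) w :
  symmetric e -> (0 < #|T|)%N -> has_dsequence e d ->
  (forall x, 0 <= w x) -> (forall x, 1 <= \sum_(y in cnbhd e x) w y) ->
  (domination_number e)%:R <= (24 * d.+3 + 7)%:R * \sum_x w x.
Proof.
move=> e_sym T0 /(dsequence_blocks e_sym)[L [uL allL mixL]] w0 w1.
set a := closed_adj e in mixL.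
have a_sym : symmetric a by apply: closed_adj_sym.
(* A total weight of at least 1 absorbs the additive constant 7 at the end. *)
have W1 : 1 <= \sum_x w x.
  have /card_gt0P[x _] := T0; apply: le_trans (w1 x) _.
  by rewrite [leRHS](bigID (mem (cnbhd e x))) /= lerDl sumr_ge0.
pose K := (2 * d.+3)%N.
have K0 : 0 < K%:R :> R by rewrite ltr0n.
have K4 : 0 < (4 * K)%:R :> R by rewrite ltr0n.
(* With light blocks of weight at most [1 / (4 * K)], up to [2 * K] of them weigh at most one
   half. *)
pose heavy J := 1 < (4 * K)%:R * \sum_(x <- J) w x.
have [|Js [cm [fJ szJ szcm cmJ lightJ]]] := greedy_blocks (bad := heavy) L.
  by rewrite /heavy big_nil mulr0 ltr10.
(* There are at most [K * (size Is + size Js)] mixed zones, so at most half of [size Is + size Js]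
   row blocks are crossed. This gives [size Is <= size Js + 2]. *)
pose crossed I := (2 * K < count (mixed a I) Js)%N.
have [|Is [rm [fI szI szrm rmI fewI]]] := greedy_blocks (bad := crossed) L.
  rewrite /crossed -leqNgt (eq_count (a2 := pred0)) ?count_pred0 //.
pose rep I := [pick y | all (fun x => (x \in rm) || a x y) I].
pose D := (cm ++ rm) ++ pmap rep Is.
have domD x : has (a x) D.
  have /flattenP[I IIs xI] : x \in flatten Is by rewrite fI.
  apply/hasPn => nD.
  have nDx y : a x y -> y \notin D by apply: contraL => /nD.
  have xrm : x \notin rm.
    have : x \notin D by apply: nDx; rewrite /a /closed_adj eqxx.
    by rewrite !mem_cat !negb_or => /andP[/andP[_ ->]].
  have [I' bI' subI'] := fewI I IIs.
  have xI' := subI' x xI xrm.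
  (* If [x] is undominated, each closed neighbour [y] lies in a column block mixed with [I'], the
     uncrossed block behind [I]. *)
  have cov y : a x y ->
      exists J, [/\ J \in Js, mixed a I' J & (y \in J) && (y \notin cm)].
    move=> xy; have /flattenP[J JJs yJ] : y \in flatten Js by rewrite fJ.
    exists J; split=> //; last first.
      by rewrite yJ; have := nDx y xy; rewrite !mem_cat !negb_or => /andP[/andP[->]].
    apply/andP; split.
      (* The mark [z] of [J] is in [D], so it is not adjacent to [x]: the row of [x] is not constant
         on [J]. *)
      have /hasP[z zJ zcm] := cmJ J JJs y yJ.
      apply/hasP; exists x => //; apply/hasP; exists y => //.
      apply/hasP; exists z => //; rewrite xy; case: (boolP (a x z)) => // xz.
      by have := nDx z xz; rewrite !mem_cat (zcm : z \in cm).
    (* If the columns were constant on [I'], then [y] would be adjacent to every unmarked vertex of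
       [I]. So [rep I] would exist and, although it may differ from [y], would dominate [x]. *)
    apply: contraT => nvar.
    have const x' : x' \in I' -> a x' y.
      move=> x'I'; apply: contraNT nvar => x'y.
      apply/hasP; exists y => //; apply/hasP; exists x => //.
      apply/hasP; exists x' => //.
      by rewrite !(a_sym y) xy (negPf x'y).
    have ally : all (fun x' => (x' \in rm) || a x' y) I.
      apply/allP => x' x'I; case: (boolP (x' \in rm)) => //= /(subI' _ x'I).
      exact: const.
    case E: (rep I) => [z|]; last first.
      by move: E; rewrite /rep; case: pickP => // /(_ y); rewrite ally.
    have xz : a x z.
      move: E; rewrite /rep; case: pickP => // z' /allP/(_ x xI).
      by rewrite (negPf xrm) /= => xz [<-].
    by have := nDx z xz; rewrite mem_cat mem_pmap -E map_f ?orbT.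
  have := w1 x; rewrite leNgt => /negP[].
  (* The neighbours of [x] are unmarked, so those in one block [J] lie in a light sequence, and at
     most [2 * K] blocks occur. *)
  apply: (@le_lt_trans _ _ (\sum_(J <- Js | mixed a I' J) (4 * K)%:R^-1)).
    apply: le_trans (sum_cover (r := fun J y => (y \in J) && (y \notin cm)) w0 _) _.
      by move=> y; rewrite inE; apply: cov.
    rewrite big_seq_cond [leRHS]big_seq_cond; apply: ler_sum => J /andP[JJs _].
    have [J' lJ' subJ'] := lightJ J JJs.
    rewrite -[leRHS]mulr1 ler_pdivlMl //.
    apply: (@le_trans _ _ ((4 * K)%:R * \sum_(y <- J') w y)).
      rewrite ler_wpM2l //; apply: sum_sub_seq => // y /andP[yJ ycm].
      exact: subJ'.
    by rewrite leNgt.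
  rewrite big_const_seq iter_addr_0 -[X in X < _]mulr_natr mulrC.
  rewrite ltr_pdivrMr // mul1r ltr_nat.
  have K0n : (0 < K)%N by [].
  move: bI'; rewrite /crossed -leqNgt => /leq_ltn_trans; apply.
  by rewrite ltn_pmul2r.
have szD : (size D <= size Js + 2 * size Is)%N.
  have szr : (size (pmap rep Is) <= size Is)%N by rewrite size_pmap count_size.
  rewrite mul2n -addnn addnA !size_cat; apply: leq_add szr.
  exact: leq_add.
have cJ : (count heavy Js)%:R <= (4 * K)%:R * \sum_x w x.
  by apply: count_heavy_blocks; rewrite ?fJ.
have cI : (2 * K * count crossed Is <= K * (size Is + size Js))%N.
  exact: leq_trans (count_sum_bound _ _ _) (mixL _ _ fI fJ).
have szDJ : (size D <= 3 * count heavy Js + 7)%N.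
  (* The hypotheses give [i <= j + 2], hence [n <= 3 * j + 4 <= 3 * h + 7]. *)
  have arith (n j i h c : nat) : (n <= j + 2 * i -> j <= h.+1 -> i <= c.+1 ->
      2 * c <= i + j -> n <= 3 * h + 7)%N by lia.
  apply: arith szD szJ szI _; rewrite -(leq_pmul2l (m := K)) //.
  by rewrite mulnCA mulnA.
apply: (@le_trans _ _ (3 * count heavy Js + 7)%:R).
  by rewrite ler_nat; apply: leq_trans (domination_number_le domD) szDJ.
rewrite natrD [(24 * _ + 7)%:R]natrD mulrDl lerD //; last by rewrite ler_peMr.
(* The factor 24 is 3 times 4 times the 2 in [K]. *)
rewrite natrM; apply: (@le_trans _ _ (3%:R * ((4 * K)%:R * \sum_x w x))).
  by rewrite ler_wpM2l.
by rewrite mulrA -natrM /K !mulnA.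
Qed.

End FractionalDomination.

(** * Passing to the optimum of the linear program *)

Unset Implicit Arguments.
Local Open Scope ring_scope.

Theorem mainTheorem14 (R : realType) (t : nat) :
  exists c : R, forall (T : finType) (e : rel T),
    symmetric e -> irreflexive e -> (0 < #|T|)%N -> tww_le e t ->
    (domination_number e)%:R <= c * frac_domination_number R e.
Proof.
exists (24 * t.+3 + 7)%:R => T e e_sym _ T0 [d [dt dseq]].
rewrite -ler_pdivrMl ?ltr0n ?addnS //; apply: lb_le_inf.
  (* The all-ones function is feasible, so the infimum is over a nonempty set and any lower bound is
     below it. *)
  exists (\sum_(x : T) 1), (fun=> 1) => //; split=> x; last by rewrite ler01 lexx.
  by rewrite (bigD1 x) ?inE ?eqxx //= lerDl sumr_ge0.
move=> _ [w [w1 w01] <-]; rewrite ler_pdivrMl ?ltr0n ?addnS //.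
have w0 x : 0 <= w x by have /andP[] := w01 x.
apply: le_trans (domination_number_le_weight e_sym T0 dseq w0 w1) _.
rewrite ler_wpM2r ?sumr_ge0 // ler_nat; lia.
Qed.
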